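(* Let $m',n'$ be natural numbers, let $\{C'_i\}_{i=0}^{m'-1}$ be a set of $m'$ (distinct) columns and $\{R'_i\}_{i=0}^{n'-1}$ a set of $n'$ (distinct) rows. Let $p$ be the least number such that some $p$ sum diagonals $\{S'_i\}_{i=0}^{p-1}$ and some $p$ difference diagonals $\{D'_i\}_{i=0}^{p-1}$ suffice to cover the spaced grid $G(\{C'_i\}_{i=0}^{m'-1},\{R'_i\}_{i=0}^{n'-1})$. Then $$p\ \ge\ \begin{cases}(m'+n'-2)/2+1 & \text{if } m' \text{ and } n' \text{ are both odd},\\ (m'+n'-2)/2 & \text{otherwise.}\end{cases}$$
   Context: Natural numbers are positive integers. Cells of a chessboard are identified by integer coordinates $(x,y)$, with $x$ the column number and $y$ the row number. A column is the set of all cells with a fixed integer $x$; a row is the set of all cells with a fixed integer $y$; a sum diagonal is the set of all cells with a fixed value of $x+y$; a difference diagonal is the set of all cells with a fixed value of $x-y$. The spaced grid with columns $\{C'_i\}_{i=0}^{m'-1}$ and rows $\{R'_i\}_{i=0}^{n'-1}$ is the set of cells $G(\{C'_i\}_{i=0}^{m'-1},\{R'_i\}_{i=0}^{n'-1})=\left(\bigcup_{i=0}^{m'-1}C'_i\right)\cap\left(\bigcup_{i=0}^{n'-1}R'_i\right)$, i.e. the $m'n'$ cells lying in one of the given columns and one of the given rows. The columns (and the rows) need not be consecutive or evenly spaced. A family of diagonals covers a set of cells if every cell of the set lies in at least one diagonal of the family. *)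

(* Defs.v *)
From mathcomp Require Import all_boot all_order all_algebra.
From mathcomp Require Import boolp classical_sets.

Set Implicit Arguments.
Unset Strict Implicit.
Unset Printing Implicit Defensive.

Local Open Scope ring_scope.
Local Open Scope classical_set_scope.

(* (x, y) is the cell in column number x and row number y. *)
Definition cell : Type := (int * int)%type.

Definition is_column (A : set cell) : Prop :=
  exists k : int, A = [set z : cell | z.1 = k].

Definition is_row (A : set cell) : Prop :=
  exists k : int, A = [set z : cell | z.2 = k].

Definition is_sum_diagonal (A : set cell) : Prop :=
  exists k : int, A = [set z : cell | z.1 + z.2 = k].

Definition is_difference_diagonal (A : set cell) : Prop :=
  exists k : int, A = [set z : cell | z.1 - z.2 = k].

Definition spaced_grid (m n : nat) (C : 'I_m -> set cell)
    (R : 'I_n -> set cell) : set cell :=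
  (\bigcup_i C i) `&` (\bigcup_i R i).

(* Injectivity makes the p lines of each kind pairwise distinct. *)
Definition diagonals_suffice (G : set cell) (p : nat) : Prop :=
  exists S D : 'I_p -> set cell,
    [/\ injective S /\ (forall i, is_sum_diagonal (S i)),
        injective D /\ (forall i, is_difference_diagonal (D i))
      & G `<=` (\bigcup_i S i) `|` (\bigcup_i D i)].

Definition least_nat (P : nat -> Prop) (p : nat) : Prop :=
  P p /\ (forall q : nat, P q -> (p <= q)%N).

(* Main.v *)
Require Import Defs.
From mathcomp Require Import all_boot all_order all_algebra.
From mathcomp Require Import boolp classical_sets.
From mathcomp Require Import ring lra zify.

(** The proof is the polynomial method. If sum diagonals [x + y = s_k] and
    difference diagonals [x - y = d_k], [q] of each kind, cover a grid [A * B],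
    then the polynomial
      [f = \prod_k (x + y - s_k) (x - y - d_k)]
    of degree [2 q] vanishes on [A * B]. Its homogeneous part of degree [2 q]
    does not depend on the diagonals: it is [(x^2 - y^2)^q], whose monomials
    are exactly those with two even exponents of sum [2 q].

    Suppose that [|A| = 2 u + 1], [|B| = 2 v + 1] and [q = u + v]. Then
    [f] has the coefficient [(-1)^v 'C(u + v, v) <> 0] at [x^(2 u) y^(2 v)].
    But this coefficient is a weighted sum of the values of [f] on the grid,
    hence zero: there are weights on [A] that extract from a polynomial of
    degree at most [2 u] its coefficient of degree [2 u]
    ([top_moment_weights]), likewise on [B], and the product weights kill every
    other monomial of degree at most [2 u + 2 v], since such a monomial has an
    exponent that is too small in one of the two variables. So no
    [(2 u + 1) * (2 v + 1)] grid is covered by [u + v] diagonals of each kind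
    ([odd_grid_not_covered]).

    An [m * n] grid contains a grid with these odd side lengths for every
    [u <= (m - 1) / 2] and [v <= (n - 1) / 2], so the number of diagonals of
    each kind exceeds the sum of the integer parts of [(m - 1) / 2] and
    [(n - 1) / 2] ([spaced_grid_diagonals_gt]). This is the stated bound,
    the gain of one when [m] and [n] are odd being that nothing is lost in the
    rounding. *)

Local Open Scope ring_scope.

Import Order.TTheory GRing.Theory Num.Theory.

(** The weights solve a linear system whose matrix is the Vandermonde matrix of
    the nodes; on polynomials of degree at most [n] they compute the leading
    divided difference. *)
Lemma top_moment_weights (F : fieldType) (n : nat) (a : 'I_n.+1 -> F) :
  injective a ->
  exists w : 'I_n.+1 -> F,
    forall k, (k <= n)%N -> \sum_i w i * a i ^+ k = (k == n)%:R.
Proof.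
move=> a_inj; pose V := Vandermonde n.+1 (\row_i a i).
have V_unit : V \in unitmx.
  rewrite unitmxE det_Vandermonde unitfE; apply/prodf_neq0 => i _.
  apply/prodf_neq0 => j ltij; rewrite !mxE subr_eq0 (inj_eq a_inj).
  by apply: contraTneq ltij => ->; rewrite ltnn.
pose w : 'cV[F]_n.+1 := invmx V *m delta_mx ord_max 0.
exists (fun i => w i 0) => k le_kn.
have := mulKVmx V_unit (delta_mx ord_max (0 : 'I_1)).
move=> /matrixP/(_ (Ordinal (le_kn : (k < n.+1)%N)) 0).
rewrite !mxE eqxx andbT -val_eqE /= => <-.
by apply: eq_bigr => i _; rewrite !mxE mulrC.
Qed.

Lemma grid_moments (F : fieldType) (m n : nat) (a : 'I_m -> F) (b : 'I_n -> F)
    (w : 'I_m -> F) (v : 'I_n -> F) (k l : nat) :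
  \sum_z w z.1 * v z.2 * (a z.1 ^+ k * b z.2 ^+ l) =
  (\sum_i w i * a i ^+ k) * (\sum_j v j * b j ^+ l).
Proof.
rewrite big_distrl /=; under [RHS]eq_bigr do rewrite big_distrr /=.
by rewrite pair_bigA /=; apply: eq_bigr => z _; rewrite mulrACA.
Qed.

Lemma sum_line_factor (F : fieldType) (I : finType) (w x y P : I -> F)
    (k l : nat) (al be c : F) :
  \sum_z w z * (x z ^+ k * y z ^+ l) * ((al * x z + be * y z - c) * P z) =
  al * (\sum_z w z * (x z ^+ k.+1 * y z ^+ l) * P z) +
  be * (\sum_z w z * (x z ^+ k * y z ^+ l.+1) * P z) -
  c * (\sum_z w z * (x z ^+ k * y z ^+ l) * P z).
Proof.
rewrite !mulr_sumr -big_split -sumrB /=.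
by apply: eq_bigr => z _; rewrite !exprS; ring.
Qed.

(** Expanding the product of lines gives only monomials of degree below [N].
    The monomial factor is there for the induction: expanding one line moves
    [x] or [y] into it. *)
Lemma sum_lines_eq0 (F : fieldType) (I : finType) (w x y : I -> F) (N : nat)
    (L : seq (F * F * F)) (k l : nat) :
  (forall k l, (k + l < N)%N -> \sum_z w z * (x z ^+ k * y z ^+ l) = 0) ->
  (k + l + size L < N)%N ->
  \sum_z w z * (x z ^+ k * y z ^+ l) *
    \prod_(t <- L) (t.1.1 * x z + t.1.2 * y z - t.2) = 0.
Proof.
move=> low; elim: L k l => [|t L IH] k l /= degL.
  by under eq_bigr do rewrite big_nil mulr1; apply: low; lia.
under eq_bigr do rewrite big_cons.
by rewrite sum_line_factor !IH ?mulr0 ?subr0 ?addr0 //; lia.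
Qed.

(** Weights that kill all monomials of degree below [N] see only the homogeneous
    part of degree [N], so the constant terms of the lines may be dropped. *)
Lemma sum_lines_leading (F : fieldType) (I : finType) (w x y : I -> F)
    (N : nat) (L : seq (F * F * F)) (k l : nat) :
  (forall k l, (k + l < N)%N -> \sum_z w z * (x z ^+ k * y z ^+ l) = 0) ->
  (k + l + size L <= N)%N ->
  \sum_z w z * (x z ^+ k * y z ^+ l) *
    \prod_(t <- L) (t.1.1 * x z + t.1.2 * y z - t.2) =
  \sum_z w z * (x z ^+ k * y z ^+ l) *
    \prod_(t <- L) (t.1.1 * x z + t.1.2 * y z).
Proof.
move=> low; elim: L k l => [|t L IH] k l /= degL.
  by under eq_bigr do rewrite big_nil; under [RHS]eq_bigr do rewrite big_nil.
under eq_bigr do rewrite big_cons.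
under [RHS]eq_bigr do rewrite big_cons -[_ + _]subr0.
rewrite !sum_line_factor mul0r.
rewrite (sum_lines_eq0 _ _ _ _ _ _ _ k l low) ?mulr0; last by lia.
by rewrite !IH //; lia.
Qed.

(** Characteristic zero is what keeps the binomial coefficient of the critical
    monomial [x^(2 u) y^(2 v)] from vanishing. *)
Lemma odd_grid_not_covered (F : numFieldType) (u v : nat)
    (a : 'I_u.*2.+1 -> F) (b : 'I_v.*2.+1 -> F) (s d : 'I_(u + v) -> F) :
  injective a -> injective b ->
  ~ (forall i j, exists k, a i + b j = s k \/ a i - b j = d k).
Proof.
move=> a_inj b_inj cover.
have [wa Ea] := top_moment_weights _ _ _ a_inj.
have [wb Eb] := top_moment_weights _ _ _ b_inj.
pose w (z : 'I_u.*2.+1 * 'I_v.*2.+1) := wa z.1 * wb z.2.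
pose x (z : 'I_u.*2.+1 * 'I_v.*2.+1) := a z.1.
pose y (z : 'I_u.*2.+1 * 'I_v.*2.+1) := b z.2.
have moment k l : (k + l <= u.*2 + v.*2)%N ->
    \sum_z w z * (x z ^+ k * y z ^+ l) = ((k == u.*2) && (l == v.*2))%:R.
  move=> deg; rewrite grid_moments.
  (* If k exceeds u.*2, the sum over a is unknown, but then l is below v.*2 and
     the sum over b vanishes. *)
  have [lt_k|le_k] := ltnP k u.*2.
    by rewrite Ea ?(ltnW lt_k) // (ltn_eqF lt_k) mul0r.
  have le_l : (l <= v.*2)%N by lia.
  rewrite (Eb _ le_l); case: eqP => [El|_]; last by rewrite mulr0 andbF.
  by rewrite Ea ?andbT ?mulr1 //; lia.
have low k l : (k + l < u.*2 + v.*2)%N ->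
    \sum_z w z * (x z ^+ k * y z ^+ l) = 0.
  move=> deg; rewrite moment ?(ltnW deg) //.
  by case: eqP => // Ek; case: eqP => // El; lia.
pose L := [seq (1, 1, s k) | k : 'I_(u + v)] ++
          [seq (1, -1, d k) | k : 'I_(u + v)] : seq (F * F * F).
have szL : size L = (u.*2 + v.*2)%N.
  by rewrite size_cat !size_image card_ord; lia.
have := sum_lines_leading _ _ _ _ _ _ L 0 0 low.
rewrite szL => /(_ (leqnn _)).
(* The covering makes the full product vanish at every grid point. *)
rewrite big1 => [/esym|z _]; last first.
  apply/eqP; rewrite mulf_eq0; apply/orP; right.
  rewrite big_cat !big_image mulf_eq0 /= /x /y.
  have [k [Ek|Ek]] := cover z.1 z.2; apply/orP.
    by left; apply/prodf_eq0; exists k; rewrite // !mul1r Ek subrr.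
  by right; apply/prodf_eq0; exists k; rewrite // mul1r mulN1r Ek subrr.
under eq_bigr => z _.
  have -> : \prod_(t <- L) (t.1.1 * x z + t.1.2 * y z) =
            \sum_(j < (u + v).+1) (-1) ^+ j *+ 'C(u + v, j) *
              (x z ^+ (u + v - j).*2 * y z ^+ j.*2).
    rewrite big_cat !big_image /= !prodr_const card_ord -exprMn.
    rewrite !mul1r mulN1r mulrC -subr_sqr exprBn.
    apply: eq_bigr => j _; rewrite -!exprM !mul2n mulrnAl; congr (_ *+ _).
    by rewrite mulrA.
  rewrite mulr_sumr; under eq_bigr do rewrite !mulr1 mulrCA; over.
rewrite exchange_big /=.
under eq_bigr => j _.
  rewrite -mulr_sumr moment; last by case: j => j /= ltj; lia.
  over.
(* The term of index v of the binomial expansion is the critical monomial. *)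
have ltv : (v < (u + v).+1)%N by rewrite ltnS leq_addl.
rewrite (bigD1 (Ordinal ltv)) //= big1 => [|j ne_jv].
  rewrite addnK !eqxx mulr1 addr0 -mulr_natr => /eqP; apply/negP.
  by rewrite mulf_neq0 ?signr_eq0 // pnatr_eq0 -lt0n bin_gt0 leq_addl.
suff /negPf -> : (j.*2 != v.*2)%N by rewrite andbF mulr0.
by apply: contra ne_jv => /eqP Ej; apply/eqP/val_inj => /=; lia.
Qed.

Lemma odd_subgrid (m n p : nat) :
  (0 < m)%N -> (0 < n)%N -> (p <= m.-1./2 + n.-1./2)%N ->
  exists u v : nat, [/\ (u.*2 < m)%N, (v.*2 < n)%N & p = (u + v)%N].
Proof.
by move=> m0 n0 pmn; exists (minn p m.-1./2), (p - minn p m.-1./2)%N; split; lia.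
Qed.

Lemma spaced_grid_diagonals_gt (m n p : nat)
    (C : 'I_m -> set cell) (R : 'I_n -> set cell) :
  (0 < m)%N -> (0 < n)%N ->
  (forall i, is_column (C i)) -> injective C ->
  (forall i, is_row (R i)) -> injective R ->
  diagonals_suffice (spaced_grid C R) p -> (m.-1./2 + n.-1./2 < p)%N.
Proof.
move=> m_gt0 n_gt0 /choice[c Cc] C_inj /choice[r Rr] R_inj.
move=> [S [D [[_ /choice[s Ss]] [_ /choice[d Dd]] cover]]].
rewrite ltnNge; apply/negP.
move=> /(odd_subgrid _ _ _ m_gt0 n_gt0)[u [v [ltu ltv Ep]]]; subst p.
have c_inj : injective c by move=> i j Eij; apply: C_inj; rewrite !Cc Eij.
have r_inj : injective r by move=> i j Eij; apply: R_inj; rewrite !Rr Eij.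
pose a i : rat := (c (widen_ord ltu i))%:~R.
pose b j : rat := (r (widen_ord ltv j))%:~R.
apply: (odd_grid_not_covered rat u v a b (fun k => (s k)%:~R)
          (fun k => (d k)%:~R)).
- by move=> i j /intr_inj /c_inj [Eij]; apply: val_inj.
- by move=> i j /intr_inj /r_inj [Eij]; apply: val_inj.
move=> i j; set i' := widen_ord ltu i; set j' := widen_ord ltv j.
have : spaced_grid C R (c i', r j').
  by split; [exists i'; rewrite ?Cc | exists j'; rewrite ?Rr].
case/cover => -[k _].
  by rewrite Ss /= => Ek; exists k; left; rewrite -Ek rmorphD.
by rewrite Dd /= => Ek; exists k; right; rewrite -Ek rmorphB.
Qed.

Theorem lemma4p3 (m n : nat) (m_gt0 : (0 < m)%N) (n_gt0 : (0 < n)%N)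
    (C : 'I_m -> set cell) (R : 'I_n -> set cell)
    (C_column : forall i, is_column (C i)) (C_inj : injective C)
    (R_row : forall i, is_row (R i)) (R_inj : injective R)
    (p : nat)
    (p_least : least_nat (diagonals_suffice (spaced_grid C R)) p) :
  p%:R >= (if odd m && odd n then (m%:R + n%:R - 2) / 2 + 1
           else (m%:R + n%:R - 2) / 2) :> rat.
Proof.
have [p_suffices _] := p_least.
have lt_p : (m.-1./2 + n.-1./2 < p)%N by exact: spaced_grid_diagonals_gt.
have natW k l : (k <= l)%N -> k%:R <= l%:R :> rat by rewrite ler_nat.
case: ifP => [/andP[odd_m odd_n]|not_odd].
  have /natW : (m + n <= p + p)%N by lia.
  by rewrite !natrD; lra.
have /natW : (m + n <= p + p + 2)%N by lia.
by rewrite !natrD; lra.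
Qed.
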